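(* Consider the centered model described in the context with gamma mixing variables, $V_1,\dots,V_n$ independent $\mathrm{Gamma}(\alpha,\beta_0)$ with shape $\alpha>0$ and rate $\beta_0>0$. Fix $i\in\{1,\dots,n\}$, let $K$ be invertible, and let $y\in\mathbb{R}^m$ be such that the marginal density $\pi(y)$ of $Y$ at $y$ satisfies $0<\pi(y)<\infty$. Then the posterior expectation $$\mathbb{E}\left[\left|\frac{(KW)_i+\mu h_i}{V_i}\right|\,\middle|\,Y=y\right]$$ is finite if and only if $\alpha>1/2$. In particular, it diverges whenever $\alpha\le 1/2$.
   Context: Centered model: $A\in\mathbb{R}^{m\times n}$, $K\in\mathbb{R}^{n\times n}$, a design matrix $X$ with regression coefficient vector $\beta$, $h\in\mathbb{R}^n$, $\mu\in\mathbb{R}$, $\sigma>0$, $\sigma_\epsilon>0$ are fixed; $Y\mid W,V\sim N(X\beta+AW,\sigma_\epsilon^2I)$ with values in $\mathbb{R}^m$; $KW\mid V\sim N(\mu V-\mu h,\mathrm{diag}(\sigma^2V))$ with $W\in\mathbb{R}^n$; the mixing variables $V=(V_1,\dots,V_n)$ have the stated gamma prior, with density proportional to $v^{\alpha-1}e^{-\beta_0v}$ on $(0,\infty)$. *)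

(* Defs.v *)
From HB Require Import structures.
From mathcomp Require Import all_boot all_order all_algebra.
From mathcomp Require Import all_classical all_reals all_analysis.

Set Implicit Arguments.
Unset Strict Implicit.
Unset Printing Implicit Defensive.

Import Order.TTheory GRing.Theory Num.Theory.
Import numFieldNormedType.Exports.

Local Open Scope classical_set_scope.
Local Open Scope ring_scope.

(* R^n is represented twice: by [n.-tuple R], which carries the product
   sigma-algebra, and by ['cV[R]_n], on which matrices act. *)
Definition colt (R : realType) (n : nat) (t : n.-tuple R) : 'cV[R]_n :=
  \col_i tnth t i.

Definition tcol (R : realType) (n : nat) (x : 'cV[R]_n) : n.-tuple R :=
  [tuple x i 0 | i < n].

Definition consT (R : realType) (n : nat) (p : measurableTypeR R * n.-tuple R) :
  n.+1.-tuple R := [tuple of p.1 :: p.2].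

Lemma measurable_consT (R : realType) (n : nat) :
  measurable_fun [set: measurableTypeR R * n.-tuple R] (@consT R n).
Proof. exact: measurable_cons. Qed.

Section lebesgue_succ.
Context (R : realType) (n : nat).
Variable m : {sigma_finite_measure set (n.-tuple R) -> \bar R}.
Local Open Scope ereal_scope.

Definition lebesgue_succ : set (n.+1.-tuple R) -> \bar R :=
  pushforward (@lebesgue_measure R \x m) (@consT R n).

Let lebesgue_succ0 : lebesgue_succ set0 = 0.
Proof. by rewrite /lebesgue_succ /pushforward preimage_set0 measure0. Qed.

Let lebesgue_succ_ge0 A : 0 <= lebesgue_succ A.
Proof. exact: (measure_ge0 (@lebesgue_measure R \x m)). Qed.

Let lebesgue_succ_sigma_additive : semi_sigma_additive lebesgue_succ.
Proof.
have mcons A : measurable A -> measurable (@consT R n @^-1` A).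
  by move=> mA; rewrite -[X in measurable X]setTI; exact: measurable_consT.
move=> F mF tF mUF; rewrite /lebesgue_succ /pushforward preimage_bigcup.
apply: measure_semi_sigma_additive.
- by move=> k; exact: mcons.
- apply/trivIsetP => /= i j _ _ ij; rewrite -preimage_setI.
  by move/trivIsetP : tF => /(_ _ _ _ _ ij) ->//; rewrite preimage_set0.
- by rewrite -preimage_bigcup; exact: mcons.
Qed.

HB.instance Definition _ := isMeasure.Build _ _ _ lebesgue_succ
  lebesgue_succ0 lebesgue_succ_ge0 lebesgue_succ_sigma_additive.

Let lebesgue_succ_sigma_finite : sigma_finite setT lebesgue_succ.
Proof.
pose splitT (t : n.+1.-tuple R) : measurableTypeR R * n.-tuple R :=
  (tnth t ord0, [tuple of behead t]).
have mS : measurable_fun setT splitT.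
  by apply/measurable_fun_pairP; split;
    [exact: measurable_tnth | exact: measurable_behead].
have splitK : cancel (@consT R n) splitT.
  move=> [x t]; rewrite /splitT /consT; congr pair => //=.
  by apply/val_inj.
have /sigma_finiteP[F [TF ndF Foo]] := sigma_finiteT (@lebesgue_measure R).
have /sigma_finiteP[G [TG ndG Goo]] := sigma_finiteT m.
exists (fun k => splitT @^-1` (F k `*` G k)).
  rewrite -preimage_bigcup (_ : \bigcup_k _ = setT) ?preimage_setT//.
  apply/seteqP; split => // -[x t] _.
  have [j _ Fx] : (\bigcup_k F k) x by rewrite -TF.
  have [k _ Gt] : (\bigcup_k G k) t by rewrite -TG.
  exists (maxn j k) => //; split => /=.
    by move: Fx; apply/subsetPset/ndF/leq_maxl.
  by move: Gt; apply/subsetPset/ndG/leq_maxr.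
move=> k; have [mFk Fky] := Foo k; have [mGk Gky] := Goo k; split.
  by rewrite -[X in measurable X]setTI; apply: mS => //; exact: measurableX.
rewrite /lebesgue_succ /pushforward -comp_preimage.
rewrite (_ : splitT \o _ = id) ?preimage_id; last exact/funext.
by rewrite product_measure1E// lte_mul_pinfty// ge0_fin_numE.
Qed.

HB.instance Definition _ := Measure_isSigmaFinite.Build _ _ _ lebesgue_succ
  lebesgue_succ_sigma_finite.

End lebesgue_succ.

Fixpoint lebesgue_tuple (R : realType) (n : nat) :
    {sigma_finite_measure set (n.-tuple R) -> \bar R} :=
  if n is n'.+1 then lebesgue_succ (lebesgue_tuple R n')
  else dirac ([tuple] : 0.-tuple R).

Section normal_vectors.
Context (R : realType) (n : nat).

Definition mvnormal_pdf (m : 'cV[R]_n) (S : 'M[R]_n) (x : 'cV[R]_n) : R :=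
  (Num.sqrt ((2 * pi) ^+ n * \det S))^-1 *
  expR (- (2^-1 * ((x - m)^T *m invmx S *m (x - m)) 0 0)).

Definition mvnormal_prob (m : 'cV[R]_n) (S : 'M[R]_n) (B : set (n.-tuple R)) :
    \bar R :=
  (\int[lebesgue_tuple R n]_(t in B) (mvnormal_pdf m S (colt t))%:E)%E.

End normal_vectors.

Section gamma_distribution.
Context (R : realType).
Implicit Types a b x : R.

Definition gamma_fun a : R :=
  \int[@lebesgue_measure R]_(t in `]0, +oo[) (t `^ (a - 1) * expR (- t)).

(* [a] is the shape and [b] the rate. *)
Definition gamma_pdf a b x : R :=
  if 0 < x then b `^ a / gamma_fun a * (x `^ (a - 1) * expR (- (b * x))) else 0.

Definition gamma_prob a b (B : set R) : \bar R :=
  (\int[@lebesgue_measure R]_(x in B) (gamma_pdf a b x)%:E)%E.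

End gamma_distribution.

Section conditioning.
Context (R : realType) (d : measure_display) (Omega : measurableType d).
Variable P : probability Omega R.

Definition mutually_independent (I : finType) (d' : measure_display)
    (T : measurableType d') (X : I -> Omega -> T) : Prop :=
  forall (J : {set I}) (B : I -> set T), (forall j, measurable (B j)) ->
    P [set w | forall j, j \in J -> B j (X j w)] =
    (\prod_(j in J) P (X j @^-1` B j))%E.

(* [kappa] is a version of the regular conditional distribution of [Z] given
   [U]. *)
Definition conditional_law (d1 d2 : measure_display) (S : measurableType d1)
    (T : measurableType d2) (U : Omega -> S) (Z : Omega -> T)
    (kappa : S -> set T -> \bar R) : Prop :=
  forall D B, measurable D -> measurable B ->
    P (U @^-1` D `&` Z @^-1` B) = (\int[P]_(w in U @^-1` D) kappa (U w) B)%E.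

(* [f u] is the density of the observation given [U = u]. *)
Definition marginal_density (S T : Type) (U : Omega -> S) (f : S -> T -> R)
    (y : T) : \bar R :=
  (\int[P]_w (f (U w) y)%:E)%E.

(* Bayes' formula: the posterior law of [U] given the observation [y] has density
   [f u y / marginal_density U f y] with respect to the law of [U]. *)
Definition posterior_expectation (S T : Type) (U : Omega -> S)
    (f : S -> T -> R) (y : T) (g : S -> R) : \bar R :=
  (\int[P]_w (g (U w) * f (U w) y)%:E / marginal_density U f y)%E.

End conditioning.

(* Main.v *)
(* Put [T := (KW)_i + mu * h_i]. Given [V], [T] is normal with mean [mu * V_i] and
   variance [sigma ^+ 2 * V_i], so on the event that [V_i] is of order [r ^+ 2] the
   ratio [T / V_i] is of order [1 / r], while the gamma prior gives this event a
   probability of order [r `^ (2 * alpha)]. The likelihood of [y] is bounded above,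
   and bounded below on the event that [KW] is bounded. The posterior expectation
   is therefore finite if and only if [\sum_k (2 ^+ k) `^ (1 - 2 * alpha)] is, the
   sum being over the scales [r = 2 ^- k]; the event [1 < V_i] contributes a finite
   amount. On each cell [a < V_i <= b] the conditional normal density of [T] is
   dominated by one fixed normal density, which reduces the upper bound to an
   integral over the real line. *)

Require Import Defs.
From mathcomp Require Import all_boot all_order all_algebra.
From mathcomp Require Import all_classical all_reals all_analysis.
From mathcomp Require Import measurable_realfun normal_distribution ring lra.
Set Implicit Arguments.
Unset Strict Implicit.
Import Order.TTheory GRing.Theory Num.Theory.
Import numFieldNormedType.Exports.
Local Open Scope classical_set_scope.
Local Open Scope ring_scope.

(* No measurability is needed: the integral of a nonnegative function is a
   supremum over the simple functions below it. *)
Lemma ge0_le_integral_subset (R : realType) (d : measure_display)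
    (T : measurableType d) (mu : {measure set T -> \bar R}) (D E : set T)
    (f g : T -> \bar R) :
  D `<=` E -> (forall x, D x -> 0 <= f x)%E -> (forall x, E x -> 0 <= g x)%E ->
  (forall x, D x -> f x <= g x)%E ->
  (\int[mu]_(x in D) f x <= \int[mu]_(x in E) g x)%E.
Proof.
move=> DE f0 g0 fg; rewrite !ge0_integralE//=.
apply: ge_ereal_sup => _ [h /= hf <-]; apply: ereal_sup_ubound; exists h => //= x.
apply: (le_trans (hf x)); rewrite /patch; case: ifPn => xD.
  by rewrite mem_set; [apply/fg/set_mem|apply/DE/set_mem].
by case: ifPn => // /set_mem/g0.
Qed.

(** * Product integrals and Gaussian vectors with diagonal covariance *)

(** Induction on [n]: [lebesgue_tuple] is built as the image of a product measure under [consT], so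
    Tonelli's theorem splits off one coordinate at a time. The base case is a Dirac mass at the
    empty tuple and an empty product. *)
Lemma integral_lebesgue_tuple_prod (R : realType) (n : nat) (g : 'I_n -> R -> R) :
  (forall j, measurable_fun setT (g j)) -> (forall j x, 0 <= g j x) ->
  (\int[lebesgue_tuple R n]_t (\prod_(j < n) g j (tnth t j))%:E =
   \prod_(j < n) \int[@lebesgue_measure R]_x (g j x)%:E)%E.
Proof.
elim: n g => [|n IHn] g mg g0.
  rewrite big_ord0 [LHS]integral_dirac//.
    by rewrite diracT mul1e big_ord0.
  by under eq_fun do rewrite big_ord0; exact: measurable_cst.
pose F (p : measurableTypeR R * n.-tuple R) : \bar R :=
  ((g ord0 p.1)%:E * (\prod_(j < n) g (lift ord0 j) (tnth p.2 j))%:E)%E.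
have mprod (k : nat) (h : 'I_k -> R -> R) :
    (forall j, measurable_fun setT (h j)) ->
    measurable_fun setT (fun t : k.-tuple R => \prod_(j < k) h j (tnth t j) : R).
  move=> mh; apply/measurable_prod => j _.
  exact: (measurableT_comp (mh j) (measurable_tnth j)).
have mF : measurable_fun setT F.
  apply: emeasurable_funM.
    by apply/measurable_EFinP/(measurableT_comp (mg ord0)); exact: measurable_fst.
  apply/measurable_EFinP.
  by apply/(measurableT_comp (mprod _ (fun j => g (lift ord0 j)) _)).
have F0 p : (0 <= F p)%E.
  by apply: mule_ge0; rewrite lee_fin//; apply: prodr_ge0.
transitivity (\int[@lebesgue_measure R \x lebesgue_tuple R n]_p F p)%E.
  rewrite [LHS](@ge0_integral_pushforward _ _ _ _ R _ (@measurable_consT R n)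
    (@lebesgue_measure R \x lebesgue_tuple R n)%E)//.
  - rewrite preimage_setT; apply: eq_integral => -[x t] _ /=.
    rewrite big_ord_recl EFinM; congr (_ * _%:E)%E.
    by apply: eq_bigr => j _; rewrite tnthS.
  - apply/measurable_EFinP; exact: mprod.
  - by move=> t _; rewrite lee_fin prodr_ge0.
rewrite fubini_tonelli1// big_ord_recl -IHn//.
rewrite -ge0_integralZr//; last 3 first.
- by apply/measurable_EFinP; exact: (mg ord0).
- by move=> x _; rewrite lee_fin.
- by apply: integral_ge0 => t _; rewrite lee_fin prodr_ge0.
apply: eq_integral => x _; rewrite /fubini_F /F /=.
apply: ge0_integralZl_EFin => //.
  by move=> t _; rewrite lee_fin prodr_ge0.
apply/measurable_EFinP; apply: (mprod _ (fun j => g (lift ord0 j))) => j.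
exact: mg.
Qed.

Lemma normal_pdf_posE (R : realType) (m s x : R) : 0 < s ->
  normal_pdf m s x = normal_peak s * expR (- (x - m) ^+ 2 / (s ^+ 2 *+ 2)).
Proof. by move=> s0; rewrite normal_pdfE// gt_eqF. Qed.

(** Here [s j] is a standard deviation. A diagonal matrix has a diagonal inverse, and its
    determinant is the product of its entries, so the quadratic form is a sum while the exponential
    and the normalising constant are products. *)
Lemma mvnormal_pdf_diag (R : realType) (n : nat) (a : 'cV[R]_n) (s : 'I_n -> R)
    (x : 'cV[R]_n) :
  (forall j, 0 < s j) ->
  mvnormal_pdf a (diag_mx (\row_j s j ^+ 2)) x =
  \prod_(j < n) normal_pdf (a j 0) (s j) (x j 0).
Proof.
move=> s0; pose D := diag_mx (\row_j s j ^+ 2).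
have iD : invmx D = diag_mx (\row_j (s j ^+ 2)^-1).
  have DE : D *m diag_mx (\row_j (s j ^+ 2)^-1) = 1%:M.
    rewrite mulmx_diag -(diag_const_mx n 1); congr diag_mx.
    by apply/rowP => j; rewrite !mxE mulfV// expf_neq0// gt_eqF.
  have [uD _] := mulmx1_unit DE.
  by rewrite -[LHS]mulmx1 -DE mulKmx.
have q : ((x - a)^T *m invmx D *m (x - a)) 0 0 =
    \sum_j (x j 0 - a j 0) ^+ 2 / s j ^+ 2.
  rewrite iD mxE; apply: eq_bigr => j _.
  rewrite mul_mx_diag !mxE expr2; ring.
rewrite /mvnormal_pdf q det_diag.
rewrite (_ : _ * _ = \prod_(j < n) (s j ^+ 2 * pi *+ 2)); last first.
  rewrite -[n in _ ^+ n]card_ord -prodr_const -big_split/=.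
  by apply: eq_bigr => j _; rewrite mxE; ring.
have -> : Num.sqrt (\prod_(j < n) (s j ^+ 2 * pi *+ 2)) =
    \prod_(j < n) Num.sqrt (s j ^+ 2 * pi *+ 2).
  elim/big_rec2: _ => [|j y1 y2 _ <-]; first by rewrite sqrtr1.
  rewrite sqrtrM//; apply: mulrn_wge0; apply: mulr_ge0; [exact: sqr_ge0|].
  exact/ltW/pi_gt0.
rewrite -prodfV mulr_sumr -sumrN expR_sum -big_split/=.
apply: eq_bigr => j _; rewrite normal_pdf_posE// /normal_peak; congr (_ * expR _).
by field; rewrite gt_eqF.
Qed.

Lemma mvnormal_prob_box (R : realType) (n : nat) (a : 'cV[R]_n) (s : 'I_n -> R)
    (B : 'I_n -> set R) :
  (forall j, 0 < s j) -> (forall j, measurable (B j)) ->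
  mvnormal_prob a (diag_mx (\row_j s j ^+ 2))
    [set t | forall j, B j (tnth t j)] =
  (\prod_(j < n) normal_prob (a j 0%R) (s j) (B j))%E.
Proof.
move=> s0 mB.
rewrite /mvnormal_prob integral_mkcond.
(* The indicator of a box is a product of indicators; absorbed into the factors, it leaves a product
   of one-variable functions. *)
transitivity (\int[lebesgue_tuple R n]_t
    (\prod_(j < n) (normal_pdf (a j 0) (s j) (tnth t j) * \1_(B j) (tnth t j)))%:E)%E.
  apply: eq_integral => t _; rewrite /patch; case: ifPn => [/set_mem/= tB|tB].
    congr (_%:E); rewrite mvnormal_pdf_diag//; apply: eq_bigr => j _.
    by rewrite mxE indicE mem_set ?mulr1//; exact: tB.
  have [j Bj] : exists j, ~ B j (tnth t j).
    by apply/existsNP => tB'; move: tB; rewrite notin_setE; apply.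
  by rewrite (bigD1 j)//= indicE memNset// mulr0 mul0r.
rewrite (@integral_lebesgue_tuple_prod _ _
  (fun j x => normal_pdf (a j 0) (s j) x * \1_(B j) x)).
- apply: eq_bigr => j _; rewrite /normal_prob [in RHS]integral_mkcond.
  apply: eq_integral => x _; rewrite /patch indicE.
  by case: ifPn => _; rewrite ?mulr1 ?mulr0.
- move=> j; apply: measurable_funM; first exact: measurable_normal_pdf.
  exact: measurable_indic.
- by move=> j x; rewrite mulr_ge0// normal_pdf_ge0.
Qed.

(** * Estimates for one-dimensional normal densities *)

Lemma normal_peakE (R : realType) (s : R) :
  0 < s -> normal_peak s = normal_peak 1 / s.
Proof.
move=> s0; rewrite /normal_peak expr1n mul1r -mulrnAr sqrtrM ?sqr_ge0//.
by rewrite sqrtr_sqr gtr0_norm// invfM mulrC.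
Qed.

(* With [p = x + c - mu * v] and [q = x + c - mu * a], use
   [q ^+ 2 <= 2 * p ^+ 2 + 2 * mu ^+ 2 * (v - a) ^+ 2] and
   [(v - a) ^+ 2 <= 3 * v]. *)
Lemma normal_pdf_mixture_le (R : realType) (mu c s a v x : R) :
  0 < s -> 0 < a -> a <= v -> v <= 4 * a -> v <= a + 1 ->
  normal_pdf (mu * v - c) (s * Num.sqrt v) x <=
  4 * expR (3 * mu ^+ 2 / (2 * s ^+ 2)) *
    normal_pdf (mu * a - c) (4 * s * Num.sqrt a) x.
Proof.
move=> s0 a0 av v4 va1.
have v0 : 0 < v by exact: lt_le_trans av.
have sv0 : 0 < Num.sqrt v by rewrite sqrtr_gt0.
have sa0 : 0 < Num.sqrt a by rewrite sqrtr_gt0.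
rewrite !normal_pdf_posE ?mulr_gt0//.
rewrite normal_peakE ?mulr_gt0// [normal_peak (4 * _ * _)]normal_peakE ?mulr_gt0//.
(* The leading [4] cancels the one in the widened standard deviation. Peaks are then compared
   through [a <= v], and exponentials separately. *)
rewrite [leRHS](_ : _ = normal_peak 1 / (s * Num.sqrt a) *
    (expR (3 * mu ^+ 2 / (2 * s ^+ 2)) *
     expR (- (x - (mu * a - c)) ^+ 2 / ((4 * s * Num.sqrt a) ^+ 2 *+ 2)))); last first.
  by field; rewrite !gt_eqF.
apply: ler_pM; rewrite ?expR_ge0//.
- by rewrite mulr_ge0 ?normal_peak_ge0// invr_ge0 mulr_ge0 ?ltW.
- apply: ler_wpM2l; first exact: normal_peak_ge0.
  by rewrite lef_pV2 ?posrE ?mulr_gt0// ler_pM2l// ler_wsqrtr.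
rewrite -expRD ler_expR !exprMn !sqr_sqrtr ?(ltW v0) ?(ltW a0)//.
rewrite -subr_ge0.
(* Nonnegativity of this square is what gives [h3]. *)
have := sqr_ge0 (x - (mu * v - c) - mu * (v - a)).
set p := x - (mu * v - c).
rewrite (_ : x - (mu * a - c) = p + mu * (v - a)); last by rewrite /p; ring.
move=> H.
have vv : (v - a) ^+ 2 <= 3 * v by nra.
(* Over a common denominator the claim becomes [v * q ^+ 2 <= 16 * a * (p ^+ 2 + 3 * mu ^+ 2 * v)];
   the bounds [v <= 4 * a] and [h3] prove it with a factor two to spare. *)
rewrite (_ : _ - _ = (16 * a * (p ^+ 2 + 3 * mu ^+ 2 * v) - v * (p + mu * (v - a)) ^+ 2)
     / (32 * s ^+ 2 * v * a)); last first.
  by field; rewrite !gt_eqF.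
apply: divr_ge0; last by rewrite !mulr_ge0// ltW.
have m2 : 0 <= mu ^+ 2 by exact: sqr_ge0.
have h1 : mu ^+ 2 * (v - a) ^+ 2 <= mu ^+ 2 * (3 * v) by exact: ler_wpM2l.
have h2 : v * (p + mu * (v - a)) ^+ 2 <= 4 * a * (p + mu * (v - a)) ^+ 2.
  by rewrite ler_wpM2r ?sqr_ge0.
have h3 : (p + mu * (v - a)) ^+ 2 <= 2 * p ^+ 2 + 2 * (mu ^+ 2 * (v - a) ^+ 2).
  nra.
have h4 : 0 <= a * (p ^+ 2) by rewrite mulr_ge0 ?sqr_ge0 ?ltW.
have h5 : 0 <= a * (mu ^+ 2 * v) by rewrite mulr_ge0 ?(ltW a0)// mulr_ge0 ?(ltW v0).
have h6 : 4 * a * (p + mu * (v - a)) ^+ 2 <=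
   4 * a * (2 * p ^+ 2 + 2 * (mu ^+ 2 * (3 * v))).
  rewrite ler_wpM2l//; first by rewrite mulr_ge0 ?ltW.
  apply: (le_trans h3); lra.
nra.
Qed.

(** Doubling the standard deviation slows the Gaussian decay enough to absorb the linear factor.
    First absolute moments are thereby bounded by total masses of normal densities. *)
Lemma normal_pdf_abs_le (R : realType) (m s x : R) : 0 < s ->
  `|x - m| * normal_pdf m s x <= 2 * s * (2 * normal_pdf m (2 * s) x).
Proof.
move=> s0; rewrite !normal_pdf_posE ?mulr_gt0//.
rewrite [normal_peak (2 * s)]normal_peakE ?mulr_gt0//.
rewrite [in leLHS]normal_peakE//.
set y := `|x - m| / s.
have -> : - (x - m) ^+ 2 / (s ^+ 2 *+ 2) = - (y ^+ 2 / 2).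
  by rewrite /y [(`|_| / s) ^+ 2]exprMn real_normK ?num_real//; field; rewrite gt_eqF.
have -> : - (x - m) ^+ 2 / ((2 * s) ^+ 2 *+ 2) = - (y ^+ 2 / 8).
  by rewrite /y [(`|_| / s) ^+ 2]exprMn real_normK ?num_real//; field; rewrite gt_eqF.
have y0 : 0 <= y by rewrite mulr_ge0// invr_ge0 ltW.
rewrite [leLHS](_ : _ = normal_peak 1 * (y * expR (- (y ^+ 2 / 2)))); last first.
  by rewrite /y; field; rewrite gt_eqF.
rewrite [leRHS](_ : _ = normal_peak 1 * (2 * expR (- (y ^+ 2 / 8)))); last first.
  by field; rewrite gt_eqF.
apply: ler_wpM2l; first exact: normal_peak_ge0.
(* From [(y - 2) ^+ 2 >= 0] one gets [y <= 1 + y ^+ 2 / 4], which the exponential dominates. *)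
have yle : y <= expR (y ^+ 2 / 4).
  have := expR_ge1Dx (y ^+ 2 / 4).
  by have := sqr_ge0 (y - 2); nra.
apply: (@le_trans _ _ (expR (y ^+ 2 / 4) * expR (- (y ^+ 2 / 2)))).
  by rewrite ler_wpM2r// expR_ge0.
rewrite -expRD; apply: (@le_trans _ _ (expR (- (y ^+ 2 / 8)))).
  by rewrite ler_expR; have := sqr_ge0 y; lra.
by have := expR_ge0 (- (y ^+ 2 / 8)); lra.
Qed.

(** * From bounds on probabilities to bounds on integrals *)

Import HBNNSimple.

(** A simple function is a finite combination of indicators of its level sets, and the assumed bound
    on probabilities applies to each level set. *)
Lemma integral_le_density_nnsfun (R : realType) (d d' : measure_display)
    (T : measurableType d) (S : measurableType d')
    (P : {measure set T -> \bar R}) (mu : {measure set S -> \bar R})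
    (E : set T) (U : T -> S) (p : S -> R) (h : {nnsfun S >-> R}) :
  measurable E -> measurable_fun setT U -> measurable_fun setT p ->
  (forall x, 0 <= p x) ->
  (forall B, measurable B ->
    (P (E `&` U @^-1` B) <= \int[mu]_(x in B) (p x)%:E)%E) ->
  (\int[P]_(w in E) (h (U w))%:E <= \int[mu]_x ((h x)%:E * (p x)%:E))%E.
Proof.
move=> mE mU mp p0 hP.
have mh r : measurable (h @^-1` [set r]) by [].
have mhU r : measurable (U @^-1` (h @^-1` [set r])).
  by rewrite -[X in measurable X]setTI; exact: mU.
have h0 r x : (0 <= (r * \1_(h @^-1` [set r]) x)%:E)%E.
  by rewrite EFinM nnfun_muleindic_ge0.
under eq_integral do rewrite fimfunE -fsumEFin//.
rewrite ge0_integral_fsum//; last first.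
  move=> r; apply/measurable_EFinP; apply: measurable_funTS.
  apply: measurable_funM => //.
  exact: (measurableT_comp (@measurable_indic _ _ R setT _ (mh r)) mU).
under [X in (_ <= X)%E]eq_integral.
  move=> x _; rewrite fimfunE -fsumEFin// ge0_mule_fsuml; last first.
    by move=> r; exact: h0.
  over.
rewrite ge0_integral_fsum//; first last.
- by move=> r x _; apply: mule_ge0; [exact: h0|rewrite lee_fin].
- move=> r; apply: emeasurable_funM; apply/measurable_EFinP => //.
  by apply: measurable_funM => //; exact: measurable_indic.
apply: lee_fsum => // _ [x _ <-].
have hx0 : 0 <= h x by [].
set r := h x in hx0 *.
have -> : (\int[P]_(w in E) (r * \1_(h @^-1` [set r]) (U w))%:E =
    r%:E * P (E `&` U @^-1` (h @^-1` [set r])))%E.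
  under eq_integral do rewrite EFinM.
  rewrite ge0_integralZl_EFin//; last first.
    apply/measurable_EFinP/measurable_funTS.
    exact: (measurableT_comp (@measurable_indic _ _ R setT _ (mh r)) mU).
  rewrite (_ : (fun w => _) = (fun w => (\1_(U @^-1` (h @^-1` [set r])) w)%:E))//.
  by rewrite integral_indic// setIC.
have -> : (\int[mu]_y ((r * \1_(h @^-1` [set r]) y)%:E * (p y)%:E) =
    r%:E * \int[mu]_(y in h @^-1` [set r]) (p y)%:E)%E.
  under eq_integral do rewrite EFinM -muleA.
  rewrite ge0_integralZl_EFin//; first last.
  - apply: emeasurable_funM; apply/measurable_EFinP => //.
  - by move=> y _; rewrite mule_ge0 ?lee_fin.
  rewrite [in RHS]integral_mkcond; congr (_ * _)%E.
  apply: eq_integral => y _; rewrite /patch indicE.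
  by case: ifPn => _; rewrite ?mul1e ?mul0e.
by apply: lee_wpmul2l => //; exact: hP.
Qed.

(** Monotone convergence along simple approximations [g n] of [f]. Each approximation lies below
    [f], so the right-hand side bounds every term of the sequence. *)
Lemma integral_le_density (R : realType) (d d' : measure_display)
    (T : measurableType d) (S : measurableType d')
    (P : {measure set T -> \bar R}) (mu : {measure set S -> \bar R})
    (E : set T) (U : T -> S) (p : S -> R) (f : S -> \bar R) :
  measurable E -> measurable_fun setT U -> measurable_fun setT p ->
  (forall x, 0 <= p x) ->
  (forall B, measurable B ->
    (P (E `&` U @^-1` B) <= \int[mu]_(x in B) (p x)%:E)%E) ->
  measurable_fun setT f -> (forall x, 0 <= f x)%E ->
  (\int[P]_(w in E) f (U w) <= \int[mu]_x (f x * (p x)%:E))%E.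
Proof.
move=> mE mU mp p0 hP mf f0; pose g := nnsfun_approx measurableT mf.
have gf x : (EFin \o g ^~ x) n @[n --> \oo] --> f x.
  exact: cvg_nnsfun_approx.
have ndg x : nondecreasing_seq (fun n => (g n x)%:E).
  by move=> a b ab; rewrite lee_fin; exact/lefP/nd_nnsfun_approx.
have mgU n : measurable_fun setT (fun w => (g n (U w))%:E).
  by apply/measurable_EFinP; exact: measurableT_comp.
have -> : (\int[P]_(w in E) f (U w) =
    limn (fun n => \int[P]_(w in E) (g n (U w))%:E))%E.
  rewrite -monotone_convergence//.
  - by apply: eq_integral => w _; apply/esym/cvg_lim => //; exact: gf.
  - by move=> n; exact: measurable_funTS.
  - by move=> n w _; rewrite lee_fin.
apply: lime_le.
  apply: ereal_nondecreasing_is_cvgn => a b ab.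
  apply: ge0_le_integral_subset => // w _; rewrite ?lee_fin//.
  exact/lefP/nd_nnsfun_approx.
apply: nearW => n.
apply: (le_trans (integral_le_density_nnsfun (g n) mE mU mp p0 hP)).
apply: ge0_le_integral_subset => // x _.
- by rewrite mule_ge0 ?lee_fin.
- by rewrite mule_ge0 ?lee_fin.
- apply: lee_wpmul2r; first by rewrite lee_fin.
  have -> : f x = ereal_sup (range (fun n => (g n x)%:E)).
    by apply/(cvg_unique _ (gf x))/ereal_nondecreasing_cvgn/ndg.
  by apply: ereal_sup_ubound; exists n.
Qed.

(** * Gamma mass of a cell and normal mass at its scale *)

Lemma integral_itv_oc_cst (R : realType) (l r c : R) : l <= r ->
  (\int[@lebesgue_measure R]_(x in `]l, r]) cst c%:E x = (c * (r - l))%:E)%E.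
Proof.
move=> lr; rewrite integral_cst//= lebesgue_measure_itv/= lte_fin.
by have [_|rl] := ltP l r; [|rewrite mule0 (@le_anti _ _ l r) ?lr// subrr mulr0].
Qed.

Lemma ge0_integral_itv_oc_le (R : realType) (l r hi : R) (f : R -> R) :
  l <= r -> (forall x, l < x <= r -> 0 <= f x <= hi) ->
  (\int[@lebesgue_measure R]_(x in `]l, r]) (f x)%:E <= (hi * (r - l))%:E)%E.
Proof.
move=> lr fhi.
rewrite -integral_itv_oc_cst//; apply: ge0_le_integral_subset => // x /=;
  rewrite in_itv/= => /fhi/andP[fx0 fxhi].
- by rewrite lee_fin.
- by rewrite lee_fin; exact: le_trans fxhi.
- by rewrite lee_fin.
Qed.

Lemma ge0_integral_itv_oc_ge (R : realType) (l r lo : R) (f : R -> R) :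
  l <= r -> 0 <= lo -> (forall x, l < x <= r -> lo <= f x) ->
  ((lo * (r - l))%:E <= \int[@lebesgue_measure R]_(x in `]l, r]) (f x)%:E)%E.
Proof.
move=> lr lo0 flo.
rewrite -integral_itv_oc_cst//; apply: ge0_le_integral_subset => // x /=;
  rewrite in_itv/= => /flo.
by rewrite lee_fin => /(le_trans lo0).
Qed.

Lemma gamma_fun_ge0 (R : realType) (a : R) : 0 <= gamma_fun a.
Proof. by apply: Rintegral_ge0 => x _; rewrite mulr_ge0 ?powR_ge0 ?expR_ge0. Qed.

(* If the integral defining [gamma_fun a] diverged, the junk values [fine +oo = 0]
   and [x / 0 = 0] would make [gamma_pdf] vanish; total mass one excludes this. *)
Lemma gamma_pdf_cst_gt0 (R : realType) (a b : R) :
  gamma_prob a b setT = 1%E -> 0 < b `^ a / gamma_fun a.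
Proof.
move=> H; rewrite lt_neqAle divr_ge0 ?powR_ge0 ?gamma_fun_ge0// andbT.
apply/eqP => c0; move: H; rewrite /gamma_prob integral0_eq; last first.
  by move=> x _; rewrite /gamma_pdf -c0 mul0r; case: ifP.
by move=> /eqP; rewrite eqe eq_sym oner_eq0.
Qed.

Lemma gamma_prob_itv0y (R : realType) (a b : R) :
  gamma_prob a b `]0, +oo[ = gamma_prob a b setT.
Proof.
rewrite /gamma_prob [LHS]integral_mkcond; apply: eq_integral => x _.
rewrite /patch /gamma_pdf; case: ifPn => [//|].
by rewrite notin_setE/= in_itv/= andbT => /negP/negbTE ->.
Qed.

(** The endpoints are squares so that a normal law with standard deviation [sigma * Num.sqrt v], for
    [v] in this cell, lives at scale [r]. For [r = 2 ^- k] the left endpoint of each cell is the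
    right endpoint of the next. *)
Definition sqr_itv (R : realType) (r : R) : set R := `](r / 2) ^+ 2, r ^+ 2].

(** Splitting the power of exponent [a - 1] into the power of exponent [a] divided by [x] treats
    both signs of [a - 1] at once: the numerator is bounded at the right endpoint, the denominator
    at the left one. The [3] is the factor [4] from the denominator times the relative length
    [3 / 4] of the cell. *)
Lemma gamma_prob_sqr_itv_le (R : realType) (a b r : R) :
  0 < a -> 0 < b -> 0 < r -> gamma_prob a b setT = 1%E ->
  (gamma_prob a b (sqr_itv r) <=
   (3 * (b `^ a / gamma_fun a) * (r ^+ 2) `^ a)%:E)%E.
Proof.
move=> a0 b0 r0 /gamma_pdf_cst_gt0; set c := (b `^ a / _) => c0.
have r20 : 0 < r ^+ 2 by rewrite exprn_gt0.
rewrite [X in (_ <= X%:E)%E](_ : _ =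
    c * ((r ^+ 2) `^ a / (r / 2) ^+ 2) * (r ^+ 2 - (r / 2) ^+ 2)); last first.
  by field; rewrite gt_eqF.
apply: ge0_integral_itv_oc_le; first by nra.
move=> x /andP[rx xr]; have x0 : 0 < x by apply: le_lt_trans rx; rewrite sqr_ge0.
rewrite /gamma_pdf x0 -/c mulr_ge0 ?(ltW c0) ?mulr_ge0 ?powR_ge0 ?expR_ge0//=.
rewrite ler_pM2l// -[leRHS]mulr1; apply: ler_pM; rewrite ?powR_ge0 ?expR_ge0//.
  rewrite powRB ?powRr1 ?(ltW x0)//; last by rewrite (gt_eqF x0) implybT.
  apply: ler_pM; rewrite ?powR_ge0 ?invr_ge0 ?(ltW x0)//.
    by apply: ge0_ler_powR; rewrite ?nnegrE ?(ltW a0) ?(ltW x0) ?(ltW r20).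
  by rewrite lef_pV2 ?posrE ?(ltW rx)// exprn_gt0// divr_gt0.
by rewrite -[leRHS]expR0 ler_expR oppr_le0 mulr_ge0 ?ltW.
Qed.

(** The same splitting with the endpoints exchanged; [r <= 1] keeps the exponential factor above
    [expR (- b)]. *)
Lemma gamma_prob_sqr_itv_ge (R : realType) (a b r : R) :
  0 < a -> 0 < b -> 0 < r -> r <= 1 -> gamma_prob a b setT = 1%E ->
  ((3 / 4 * (b `^ a / gamma_fun a) * 4^-1 `^ a * expR (- b) * (r ^+ 2) `^ a)%:E <=
   gamma_prob a b (sqr_itv r))%E.
Proof.
move=> a0 b0 r0 r1 /gamma_pdf_cst_gt0; set c := (b `^ a / _) => c0.
have r20 : 0 < r ^+ 2 by rewrite exprn_gt0.
rewrite [X in (X%:E <= _)%E](_ : _ =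
    c * ((4^-1 * r ^+ 2) `^ a / r ^+ 2 * expR (- b)) * (r ^+ 2 - (r / 2) ^+ 2));
    last first.
  rewrite [(4^-1 * _) `^ a]powRM ?invr_ge0 ?(ltW r20)//.
  by field; rewrite gt_eqF.
apply: ge0_integral_itv_oc_ge; first by nra.
  by rewrite mulr_ge0 ?(ltW c0) ?mulr_ge0 ?powR_ge0 ?expR_ge0 ?invr_ge0 ?(ltW r20).
move=> x /andP[rx xr]; have x0 : 0 < x by apply: le_lt_trans rx; rewrite sqr_ge0.
rewrite /gamma_pdf x0 -/c ler_pM2l//; apply: ler_pM; rewrite ?expR_ge0//.
- by rewrite mulr_ge0 ?powR_ge0// invr_ge0 ltW.
- rewrite powRB ?powRr1 ?(ltW x0)//; last by rewrite (gt_eqF x0) implybT.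
  apply: ler_pM; rewrite ?powR_ge0 ?invr_ge0 ?(ltW r20)//.
    apply: ge0_ler_powR; rewrite ?nnegrE ?(ltW a0) ?(ltW x0) ?mulr_ge0 ?(ltW r0)//.
    by apply: le_trans (ltW rx); rewrite exprMn; lra.
  by rewrite lef_pV2 ?posrE.
- rewrite ler_expR lerN2 ler_piMr ?(ltW b0)//.
  by apply: le_trans xr _; rewrite exprn_ile1// ltW.
Qed.

(** The interval has length [r], which cancels the [1 / r] of the peak. Its points are within
    [(2 + |mu|) * r] of the mean, and the variance exceeds [s ^+ 2 * r ^+ 2 / 4], so the exponent is
    bounded independently of [r]. *)
Lemma normal_prob_mixture_ge (R : realType) (mu c s r v : R) :
  0 < s -> 0 < r -> r <= 1 -> (r / 2) ^+ 2 < v -> v <= r ^+ 2 ->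
  ((normal_peak 1 / s * expR (- (2 * (2 + `|mu|) ^+ 2 / s ^+ 2)))%:E <=
   normal_prob (mu * v - c) (s * Num.sqrt v) `](r - c)%R, (2 * r - c)%R])%E.
Proof.
move=> s0 r0 r1 rv vr.
have v0 : 0 < v by apply: le_lt_trans rv; rewrite sqr_ge0.
have sv0 : 0 < Num.sqrt v by rewrite sqrtr_gt0.
have m0 := normr_ge0 mu.
rewrite [X in (X%:E <= _)%E](_ : _ =
    normal_peak 1 / (s * r) * expR (- (2 * (2 + `|mu|) ^+ 2 / s ^+ 2)) *
    ((2 * r - c) - (r - c))); last by field; rewrite !gt_eqF.
apply: ge0_integral_itv_oc_ge; first by lra.
  by rewrite !mulr_ge0 ?expR_ge0 ?normal_peak_ge0// invr_ge0 mulr_ge0 ?ltW.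
move=> x /andP[x1 x2].
rewrite normal_pdf_posE ?mulr_gt0// [normal_peak (s * _)]normal_peakE ?mulr_gt0//.
apply: ler_pM; rewrite ?expR_ge0//.
- by rewrite mulr_ge0 ?normal_peak_ge0// invr_ge0 mulr_ge0 ?ltW.
- apply: ler_wpM2l; first exact: normal_peak_ge0.
  rewrite lef_pV2 ?posrE ?mulr_gt0// ler_pM2l//.
  by rewrite -(ger0_norm (ltW r0)) -sqrtr_sqr ler_wsqrtr.
rewrite ler_expR exprMn sqr_sqrtr ?(ltW v0)// mulNr lerN2.
rewrite ler_pdivrMr; last by rewrite mulrn_wgt0// mulr_gt0// exprn_gt0.
rewrite [leRHS](_ : _ = (2 + `|mu|) ^+ 2 * (4 * v)); last first.
  by field; rewrite gt_eqF.
apply: (@le_trans _ _ ((2 + `|mu|) ^+ 2 * r ^+ 2)); last first.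
  by rewrite ler_wpM2l ?sqr_ge0//; move: rv; rewrite exprMn; lra.
rewrite -exprMn -[leLHS]real_normK ?num_real// ler_sqr ?nnegrE//; last first.
  by rewrite mulr_ge0 ?addr_ge0 ?(ltW r0).
rewrite (_ : x - _ = (x + c) - mu * v); last by ring.
apply: (le_trans (ler_normB _ _)); rewrite normrM.
rewrite (ger0_norm (ltW v0)) (@ger0_norm _ (x + c)); last by lra.
rewrite mulrDl lerD//; first by lra.
rewrite ler_wpM2l//; apply: (le_trans vr); rewrite expr2 ler_piMr ?(ltW r0)//.
Qed.

Lemma mvnormal_prob_mixture (R : realType) (n : nat) (h : 'cV[R]_n)
    (mu sigma : R) (v : n.-tuple R) (B : 'I_n -> set R) :
  0 < sigma -> (forall j, 0 < tnth v j) -> (forall j, measurable (B j)) ->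
  mvnormal_prob (mu *: colt v - mu *: h) (diag_mx (sigma ^+ 2 *: (colt v)^T))
    [set t | forall j, B j (tnth t j)] =
  (\prod_(j < n) normal_prob (mu * tnth v j - mu * h j 0%R)%R
     (sigma * Num.sqrt (tnth v j))%R (B j))%E.
Proof.
move=> sigma0 v0 mB.
rewrite (_ : sigma ^+ 2 *: _ = \row_j (sigma * Num.sqrt (tnth v j)) ^+ 2); last first.
  by apply/rowP => j; rewrite !mxE exprMn sqr_sqrtr// ltW.
rewrite mvnormal_prob_box// => [|j]; last by rewrite mulr_gt0// sqrtr_gt0.
by apply: eq_bigr => j _; rewrite !mxE.
Qed.

Lemma measurable_tuple_box d (T : measurableType d) (n : nat) (B : 'I_n -> set T) :
  (forall j, measurable (B j)) ->
  measurable [set t : n.-tuple T | forall j, B j (tnth t j)].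
Proof.
move=> mB.
rewrite (_ : [set t | _] = \bigcap_(j in [set: 'I_n]) ((@tnth n T)^~ j @^-1` B j)).
  apply: fin_bigcap_measurable; first exact: finite_finset.
  move=> j _; rewrite -[X in measurable X]setTI.
  exact: measurable_tnth.
by apply/seteqP; split=> t /= tB => [j _|j]; exact: tB.
Qed.

(** * Covers by cells, series and powers *)

(** This allows a different majorant on each cell. At a point of [D], the term of one index [k] with
    [E k x] already dominates [G x], and the other terms are nonnegative. *)
Lemma ge0_integral_cover_le (R : realType) (d : measure_display)
    (T : measurableType d) (mu : {measure set T -> \bar R}) (D : set T)
    (E : nat -> set T) (G : T -> \bar R) (f : nat -> T -> \bar R) :
  (forall k, measurable (E k)) -> (forall k, measurable_fun setT (f k)) ->
  (forall k x, 0 <= f k x)%E -> D `<=` \bigcup_k E k ->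
  (forall x, D x -> 0 <= G x)%E -> (forall k x, D x -> E k x -> G x <= f k x)%E ->
  (\int[mu]_(x in D) G x <= \sum_(k <oo) \int[mu]_(x in E k) f k x)%E.
Proof.
move=> mE mf f0 DE G0 Gf.
have fE0 k x : (0 <= (f k \_ (E k)) x)%E by rewrite /patch; case: ifP.
under eq_eseriesr do rewrite integral_mkcond.
rewrite -integral_nneseries//; last first.
  by move=> k; apply/(measurable_restrictT _ (mE k)); exact: measurable_funTS.
apply: ge0_le_integral_subset => // x => [_|Dx].
  exact: nneseries_ge0.
have [k _ Ekx] := DE _ Dx.
apply: (le_trans (Gf _ _ Dx Ekx)).
have -> : f k x = (f k \_ (E k)) x by rewrite /patch mem_set.
apply: le_trans (nneseries_lim_ge k.+1 (fun i _ _ => fE0 i x)).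
by rewrite big_mkord big_ord_recr/= leeDr// sume_ge0.
Qed.

Lemma nneseries_geometric_lty (R : realType) (c z : R) :
  0 <= c -> 0 <= z -> z < 1 -> (\sum_(k <oo) (c * z ^+ k)%:E < +oo)%E.
Proof.
move=> c0 z0 z1.
apply: (@le_lt_trans _ _ (c / (1 - z))%:E); last by rewrite ltry.
apply: lime_le.
  by apply: is_cvg_nneseries => k _ _; rewrite lee_fin mulr_ge0// exprn_ge0.
apply: nearW => m; rewrite sumEFin lee_fin big_mkord -mulr_sumr.
rewrite ler_wpM2l// -div1r ler_pdivlMr ?subr_gt0//.
have := subrX1 z m; have := exprn_ge0 m z0.
by set S := \sum_(_ < _) _; set t := z ^+ m; nra.
Qed.

(** The threshold [1 / 2] enters the convergence proof here: twice this power is the ratio of the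
    geometric series that bounds the contributions of the cells. *)
Lemma powR_quarter_lt (R : realType) (a : R) : 1 / 2 < a -> 4^-1 `^ a < (1 / 2 : R).
Proof.
move=> a2; rewrite (_ : 4^-1 = 2^-1 ^+ 2); last by field.
rewrite -powR_mulrn// -powRrM /powR (gt_eqF (_ : 0 < 2^-1))//.
rewrite [ltRHS](_ : _ = expR (ln 2^-1)); last by rewrite lnK ?posrE// div1r.
rewrite ltr_expR lnV ?posrE//.
have : 0 < ln 2 :> R by rewrite ln_gt0// ltr1n.
by nra.
Qed.

(** Take the least [k] whose left endpoint is below [v]. Minimality gives the upper bound because
    consecutive cells share an endpoint; for [k = 0] the upper bound is [v <= 1]. *)
Lemma sqr_itv_cover (R : realType) (v : R) : 0 < v -> v <= 1 ->
  exists k, sqr_itv (2^-1 ^+ k) v.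
Proof.
move=> v0 v1.
have ex : exists k, (2^-1 ^+ k / 2) ^+ 2 < v.
  exists (Num.bound v^-1); set k := Num.bound _.
  have kv : v^-1 < k%:R by apply: archi_boundP; rewrite invr_ge0 ltW.
  have k2 : k%:R < 2 ^+ k :> R by rewrite -natrX ltr_nat ltn_expl.
  have h : 2^-1 ^+ k < v.
    by rewrite exprVn invf_plt ?posrE ?exprn_gt0//; exact: lt_trans kv k2.
  have h0 : 0 < 2^-1 ^+ k :> R by rewrite exprn_gt0.
  by nra.
case: (ex_minnP ex) => k kv kmin; exists k; rewrite /sqr_itv /= in_itv/= kv/=.
case: k kv kmin => [|k] _ kmin; first by rewrite expr0 expr1n.
rewrite leNgt; apply/negP => h.
have /kmin : (2^-1 ^+ k / 2) ^+ 2 < v by rewrite -exprSr.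
by rewrite ltnn.
Qed.

Lemma unit_itv_cover (R : realType) (v : R) : 1 < v ->
  exists k : nat, k.+1%:R < v <= k.+1%:R + 1.
Proof.
move=> v1.
have ex : exists k : nat, v <= k.+1%:R + 1.
  exists (Num.bound v); have := archi_boundP (ltW (lt_trans ltr01 v1)).
  by move=> /ltW /le_trans; apply; rewrite -natr1 -addrA lerDl.
case: (ex_minnP ex) => k kv kmin; exists k; rewrite kv andbT.
case: k kv kmin => [//|k] _ kmin.
rewrite ltNge; apply/negP => h.
have /kmin : v <= k.+1%:R + 1 by rewrite natr1.
by rewrite ltnn.
Qed.

Lemma lee_prod_EFin (R : realType) (n : nat) (a : 'I_n -> R) (F : 'I_n -> \bar R) :
  (forall j, 0 <= a j) -> (forall j, (a j)%:E <= F j)%E ->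
  ((\prod_(j < n) a j)%:E <= \prod_(j < n) F j)%E.
Proof.
move=> a0 aF; rewrite -prodEFin.
have : (0 <= \prod_(j < n) (a j)%:E <= \prod_(j < n) F j)%E.
  elim/big_rec2: _ => [|j x y _ /andP[x0 xy]]; first by rewrite lee01 lexx.
  by rewrite mule_ge0 ?lee_fin//= lee_pmul// lee_fin.
by move=> /andP[].
Qed.

(** The right-hand side is [r] to the power [2 * a <= 1]. The threshold enters the divergence proof
    here: the gamma mass at scale [r] is then at least of order [r]. *)
Lemma le_powR_sqr (R : realType) (r a : R) :
  0 < r -> r <= 1 -> a <= 1 / 2 -> r <= (r ^+ 2) `^ a.
Proof.
move=> r0 r1 a2; rewrite /powR gt_eqF ?exprn_gt0//.
rewrite -[leLHS](@lnK R r) ?posrE// ler_expR lnXn// -mulr_natl.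
by have := ln_le0 r1; nra.
Qed.

(** * Joint law of the mixing variables and of [KW] *)

Section mixture_model.
Context (R : realType) (d : measure_display) (Omega : measurableType d)
  (P : probability Omega R) (n : nat) (K : 'M[R]_n) (h : 'cV[R]_n)
  (mu sigma alpha beta0 : R) (W V : {RV P >-> n.-tuple R}).
Context (sigma0 : 0 < sigma) (alpha0 : 0 < alpha) (beta00 : 0 < beta0).
Context (indep : mutually_independent P (fun (j : 'I_n) w => tnth (V w) j)).
Context (law_V : forall (j : 'I_n) (B : set R), measurable B ->
  P ((fun w => tnth (V w) j) @^-1` B) = gamma_prob alpha beta0 B).
Context (law_KW : conditional_law P V (fun w => tcol (K *m colt (W w)))
  (fun v => mvnormal_prob (mu *: colt v - mu *: h)
     (diag_mx (sigma ^+ 2 *: (colt v)^T)))).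

Let KW (j : 'I_n) (w : Omega) : R := (K *m colt (W w)) j 0.

Lemma measurable_mixing (j : 'I_n) : measurable_fun setT (fun w => tnth (V w) j).
Proof.
exact: (measurableT_comp (measurable_tnth j) (@measurable_funPT _ _ _ _ V)).
Qed.

Lemma measurable_mixingS (j : 'I_n) (B : set R) :
  measurable B -> measurable [set w | B (tnth (V w) j)].
Proof.
by move=> mB; rewrite -[X in measurable X]setTI; exact: measurable_mixing.
Qed.

Lemma measurable_cell (i : 'I_n) (a b : R) :
  measurable [set w | a < tnth (V w) i <= b].
Proof.
rewrite (_ : [set w | _] = [set w | `]a, b]%classic (tnth (V w) i)]).
  exact: measurable_mixingS.
by apply/seteqP; split=> w /=; rewrite in_itv.
Qed.

Lemma measurable_mixing_box (C : 'I_n -> set R) : (forall j, measurable (C j)) ->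
  measurable [set w | forall j, C j (tnth (V w) j)].
Proof.
move=> mC; rewrite -[X in measurable X]setTI.
have mV : measurable_fun setT V by exact: measurable_funPT.
exact: (mV measurableT _ (measurable_tuple_box mC)).
Qed.

Lemma measurable_KW (j : 'I_n) : measurable_fun setT (KW j).
Proof.
rewrite /KW; under eq_fun do rewrite mxE; apply: measurable_sum => k.
apply: measurable_funM; first exact: measurable_cst.
under eq_fun do rewrite mxE.
exact: (measurableT_comp (measurable_tnth k) (@measurable_funPT _ _ _ _ W)).
Qed.

Lemma prob_mixing_box (C : 'I_n -> set R) : (forall j, measurable (C j)) ->
  P [set w | forall j, C j (tnth (V w) j)] =
  (\prod_(j < n) gamma_prob alpha beta0 (C j))%E.
Proof.
move=> mC; have := indep [set: 'I_n]%SET mC.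
rewrite (_ : [set w | _] = [set w | forall j, C j (tnth (V w) j)]); last first.
  by apply/seteqP; split=> w /= wC j; [apply: wC; rewrite finset.in_setT|move=> _; exact: wC].
move=> ->; under eq_bigl do rewrite finset.in_setT.
by apply: eq_bigr => j _; exact: law_V.
Qed.

(** On boxes the conditional law becomes a product of one-dimensional normal probabilities; [C0]
    keeps their standard deviations positive. *)
Lemma prob_mixing_KW_box (C B : 'I_n -> set R) :
  (forall j, measurable (C j)) -> (forall j, measurable (B j)) ->
  (forall j x, C j x -> 0 < x) ->
  P ([set w | forall j, C j (tnth (V w) j)] `&` [set w | forall j, B j (KW j w)]) =
  (\int[P]_(w in [set w | forall j, C j (tnth (V w) j)])
     \prod_(j < n) normal_prob (mu * tnth (V w) j - mu * h j 0%R)%R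
       (sigma * Num.sqrt (tnth (V w) j))%R (B j))%E.
Proof.
move=> mC mB C0.
have := law_KW (measurable_tuple_box mC) (measurable_tuple_box mB).
rewrite (_ : _ @^-1` [set t | forall j, B j (tnth t j)] =
    [set w | forall j, B j (KW j w)]); last first.
  by apply/seteqP; split=> w /= wB j; have := wB j; rewrite tnth_mktuple.
move=> ->; apply: eq_integral => w /set_mem/= wC.
by rewrite mvnormal_prob_mixture// => j; exact: C0 (wC j).
Qed.

(** The normalisation of the gamma density is read off from the law of an actual random variable,
    hence the index [j]. *)
Lemma gamma_prob_mixing_setT (j : 'I_n) : gamma_prob alpha beta0 setT = 1%E.
Proof. by rewrite -(law_V j)// preimage_setT probability_setT. Qed.

(** The mixing variables are almost surely positive. Intersecting with this event puts
    [prob_mixing_KW_box] within reach. *)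
Lemma prob_le_mixing_gt0 (F : set Omega) : measurable F ->
  (P F <= P (F `&` [set w | forall j, (0 < tnth (V w) j)%R]))%E.
Proof.
move=> mF; pose pos := [set w | forall j, `]0%R, +oo[%classic (tnth (V w) j)].
rewrite (_ : [set w | _] = pos); last first.
  by apply/seteqP; split=> w /= w0 j; have := w0 j; rewrite /= in_itv/= andbT.
have mpos : measurable pos by exact: (@measurable_mixing_box (fun=> `]0, +oo[%classic)).
have Ppos : P (~` pos) = 0%E.
  rewrite probability_setC// (@prob_mixing_box (fun=> `]0, +oo[%classic))// big1 ?subee// => j _.
  by rewrite gamma_prob_itv0y (gamma_prob_mixing_setT j).
have mFp : measurable (F `&` pos) by exact: measurableI.
have mpC : measurable (~` pos) by exact: measurableC.
apply: (@le_trans _ _ (P ((F `&` pos) `|` ~` pos))).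
  apply: le_measure; rewrite ?inE//; first exact: measurableU.
  by move=> w Fw; have [?|?] := pselect (pos w); [left|right].
apply: (le_trans (measureU2 P mFp mpC)).
by rewrite -[leRHS]adde0 -Ppos.
Qed.

(** * Upper bounds on cells and convergence *)

(** This is the domination by one fixed normal density that [integral_le_density] takes as input;
    the conditions on [a] and [b] are those of [normal_pdf_mixture_le]. *)
Lemma prob_cell_KW_le (i : 'I_n) (a b : R) (B : set R) :
  0 < a -> b <= 4 * a -> b <= a + 1 -> measurable B ->
  (P ([set w | (a < tnth (V w) i <= b)%R] `&` KW i @^-1` B) <=
   \int[@lebesgue_measure R]_(x in B)
     (fine (P [set w | (a < tnth (V w) i <= b)%R]) * (4 * expR (3 * mu ^+ 2 / (2 * sigma ^+ 2)) *
       normal_pdf (mu * a - mu * h i 0) (4 * sigma * Num.sqrt a) x))%:E)%E.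
Proof.
move=> a0 b4 b1 mB.
set E := [set w | _].
have mE : measurable E by exact: measurable_cell.
(* Only coordinate [i] is constrained. Elsewhere [KW] ranges over the whole line, so the normal
   factors there are total masses, equal to one. *)
pose C j : set R := if j == i then `]a, b]%classic else `]0, +oo[%classic.
pose B' j : set R := if j == i then B else setT.
have mC j : measurable (C j) by rewrite /C; case: ifP.
have mB' j : measurable (B' j) by rewrite /B'; case: ifP.
have C0 j x : C j x -> 0 < x.
  rewrite /C; case: ifP => _ /=; rewrite in_itv/= ?andbT// => /andP[ax _].
  exact: lt_trans ax.
have mKB : measurable (KW i @^-1` B).
  by rewrite -[X in measurable X]setTI; exact: measurable_KW.
have mCV := measurable_mixing_box mC.
apply: (le_trans (prob_le_mixing_gt0 (measurableI _ _ mE mKB))).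
apply: (@le_trans _ _ (P ([set w | forall j, C j (tnth (V w) j)] `&`
    [set w | forall j, B' j (KW j w)]))).
  apply: le_measure; rewrite ?inE.
  - apply: measurableI; first exact: measurableI.
    rewrite (_ : [set w | _] = [set w | forall j, `]0%R, +oo[%classic (tnth (V w) j)]).
      exact: (@measurable_mixing_box (fun=> `]0, +oo[%classic)).
    by apply/seteqP; split=> w /= w0 j; have := w0 j; rewrite /= in_itv/= andbT.
  - apply: measurableI => //.
    rewrite (_ : [set w | _] = KW i @^-1` B)//.
    apply/seteqP; split=> w /=; rewrite /B'; first by move=> /(_ i); rewrite eqxx.
    by move=> wB j; case: eqP => [->|].
  - move=> w [[Ew wB] w0]; split=> j; rewrite /C /B'; case: eqP => [->|_] //=.
    by rewrite /= in_itv/= andbT; exact: w0.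
rewrite prob_mixing_KW_box//.
set q : R := 4 * expR _.
set m := mu * a - _; set s := 4 * sigma * _.
pose c := (\int[@lebesgue_measure R]_(x in B) (q * normal_pdf m s x)%:E)%E.
have q0 : 0 <= q by rewrite mulr_ge0 ?expR_ge0.
have c0 : (0 <= c)%E.
  by apply: integral_ge0 => x _; rewrite lee_fin mulr_ge0 ?normal_pdf_ge0.
apply: (@le_trans _ _ (\int[P]_(w in [set w | forall j, C j (tnth (V w) j)]) cst c w)%E).
  apply: ge0_le_integral_subset => // w wC; first exact: prode_ge0.
  rewrite (bigD1 i)//= [X in (_ * X)%E]big1 => [|j ji]; last first.
    by rewrite /B' (negbTE ji); exact: probability_setT.
  rewrite mule1 /B' eqxx; apply: ge0_le_integral_subset => // x _.
  - by rewrite lee_fin normal_pdf_ge0.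
  - by rewrite lee_fin mulr_ge0 ?normal_pdf_ge0.
  have := wC i; rewrite /C eqxx /= in_itv/= => /andP[av vb].
  rewrite lee_fin; apply: normal_pdf_mixture_le => //; first exact: ltW.
  - exact: le_trans b4.
  - exact: le_trans b1.
rewrite integral_cst//.
under [X in (_ <= X)%E]eq_integral do rewrite EFinM.
rewrite ge0_integralZl_EFin//; last 3 first.
- by move=> x _; rewrite lee_fin mulr_ge0 ?normal_pdf_ge0.
- apply/measurable_EFinP/measurable_funTS/measurable_funM => //.
  exact: measurable_normal_pdf.
- by rewrite fine_ge0.
rewrite fineK ?fin_num_measure// -/c muleC; apply: lee_wpmul2r => //.
apply: le_measure; rewrite ?inE// => w /= /(_ i).
by rewrite /C eqxx /E /= in_itv.
Qed.

Lemma integral_cell_abs_le (i : 'I_n) (a b : R) :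
  0 < a -> b <= 4 * a -> b <= a + 1 ->
  (\int[P]_(w in [set w | (a < tnth (V w) i <= b)%R])
     (`|KW i w + mu * h i 0| / a)%:E <=
   (4 * expR (3 * mu ^+ 2 / (2 * sigma ^+ 2)) *
     (`|mu| + 16 * sigma / Num.sqrt a))%:E *
   P [set w | (a < tnth (V w) i <= b)%R])%E.
Proof.
move=> a0 b4 b1; set E := [set w | _].
have mE : measurable E by exact: measurable_cell.
set q : R := 4 * expR _; have q0 : 0 <= q by rewrite mulr_ge0 ?expR_ge0.
have sa0 : 0 < Num.sqrt a by rewrite sqrtr_gt0.
have saa : a = Num.sqrt a ^+ 2 by rewrite sqr_sqrtr// ltW.
set m := mu * a - mu * h i 0; pose s := 4 * sigma * Num.sqrt a.
have s0 : 0 < s by rewrite !mulr_gt0.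
have pdf0 u v x : 0 <= normal_pdf u v x :> R by exact: normal_pdf_ge0.
have mpdf u v : measurable_fun [set: measurableTypeR R] (normal_pdf u v).
  exact: measurable_normal_pdf.
pose PE := fine (P E); have PE0 : 0 <= PE by rewrite fine_ge0.
pose f x : \bar R := (`|x + mu * h i 0| / a)%:E.
have f0 x : (0 <= f x)%E by rewrite lee_fin mulr_ge0// invr_ge0 ltW.
apply: (@le_trans _ _ (\int[@lebesgue_measure R]_x
    (f x * (PE * (q * normal_pdf m s x))%:E))%E).
  apply: (@integral_le_density R _ _ Omega (measurableTypeR R) P lebesgue_measure E
    (KW i) (fun x => PE * (q * normal_pdf m s x)) f) => //.
  - exact: measurable_KW.
  - by apply: measurable_funM => //; apply: measurable_funM.
  - by move=> x; rewrite !mulr_ge0.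
  - by move=> B mB; exact: prob_cell_KW_le.
  - apply/measurable_EFinP; apply: measurable_funM => //.
    by apply: measurableT_comp => //; exact: measurable_funD.
(* The first term comes from [normal_pdf_abs_le], the second from
   [|x + mu * h i 0| <= |x - m| + |mu| * a]. Both are multiples of normal densities, so [g]
   integrates to the sum of its coefficients. *)
pose g x : R := 4 * s / a * normal_pdf m (2 * s) x + `|mu| * normal_pdf m s x.
have k0 : 0 <= 4 * s / a
  by apply: divr_ge0; [apply: mulr_ge0 => //; exact: ltW|exact: ltW].
have g0 x : 0 <= g x by apply: addr_ge0; apply: mulr_ge0.
apply: (@le_trans _ _ (\int[@lebesgue_measure R]_x ((PE * q)%:E * (g x)%:E))%E).
  apply: ge0_le_integral_subset => // x _.
  - by rewrite mule_ge0// lee_fin !mulr_ge0.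
  - by rewrite mule_ge0// lee_fin ?mulr_ge0.
  rewrite -!EFinM lee_fin.
  rewrite [leLHS](_ : _ = PE * q * (`|x + mu * h i 0| / a * normal_pdf m s x));
    last by ring.
  apply: ler_wpM2l; first exact: mulr_ge0.
  have := normal_pdf_abs_le m x s0 => /(ler_wpM2r (ltW (_ : 0 < a^-1))).
  rewrite invr_gt0 => /(_ a0) H.
  have : `|x + mu * h i 0| <= `|x - m| + `|mu| * a.
    rewrite (_ : x + _ = x - m + mu * a); last by rewrite /m; ring.
    by apply: (le_trans (ler_normD _ _)); rewrite normrM (ger0_norm (ltW a0)).
  move=> /(ler_wpM2r (ltW (_ : 0 < a^-1))); rewrite invr_gt0 => /(_ a0).
  move=> /(ler_wpM2r (pdf0 m s x)) /le_trans; apply.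
  rewrite /g mulrDl mulrDl lerD//.
    move: H; rewrite [leRHS](_ : _ = 4 * s / a * normal_pdf m (2 * s) x); last by ring.
    by rewrite mulrAC.
  by rewrite mulfK// gt_eqF.
rewrite ge0_integralZl_EFin//; first last.
- by rewrite mulr_ge0.
- apply/measurable_EFinP; apply: measurable_funD; exact: measurable_funM.
- by move=> x _; rewrite lee_fin.
have -> : (\int[@lebesgue_measure R]_x (g x)%:E = (4 * s / a + `|mu|)%:E)%E.
  under eq_integral do rewrite EFinD.
  rewrite ge0_integralD//; first last.
  - by apply/measurable_EFinP; exact: measurable_funM.
  - by move=> x _; rewrite lee_fin mulr_ge0.
  - by apply/measurable_EFinP; exact: measurable_funM.
  - by move=> x _; rewrite lee_fin mulr_ge0.
  under eq_integral do rewrite EFinM.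
  rewrite ge0_integralZl_EFin//; first last.
  - by apply/measurable_EFinP.
  - by move=> x _; rewrite lee_fin.
  under [X in (_ + X)%E]eq_integral do rewrite EFinM.
  rewrite ge0_integralZl_EFin//; first last.
  - by apply/measurable_EFinP.
  - by move=> x _; rewrite lee_fin.
  by rewrite !integral_normal_pdf !mule1 EFinD.
have -> : P E = PE%:E by rewrite fineK// fin_num_measure.
rewrite -!EFinM lee_fin le_eqVlt; apply/orP; left; apply/eqP.
by rewrite /s [in X in 4 * _ / X]saa; field; rewrite gt_eqF.
Qed.

Lemma measurable_abs_KW_shift (i : 'I_n) (a : R) :
  measurable_fun setT (fun w => (`|KW i w + mu * h i 0| / a)%:E).
Proof.
apply/measurable_EFinP; apply: measurable_funM => //.
by apply: measurableT_comp => //; apply: measurable_funD => //; exact: measurable_KW.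
Qed.

Lemma prob_sqr_cell (i : 'I_n) (r : R) :
  P [set w | (r / 2) ^+ 2 < tnth (V w) i <= r ^+ 2] =
  gamma_prob alpha beta0 (sqr_itv r).
Proof.
rewrite -(law_V i); last exact: measurable_itv.
by congr (P _); apply/seteqP; split=> w /=; rewrite /sqr_itv /= in_itv.
Qed.

(** The cell at scale [2 ^- k] contributes at most a constant times [2 ^+ k] times its gamma mass,
    and the resulting series is geometric with ratio [z < 1]. *)
Lemma integral_ratio_le1_lty (i : 'I_n) : 1 / 2 < alpha ->
  (\int[P]_(w in [set w | (0 < tnth (V w) i <= 1)%R])
     (`|KW i w + mu * h i 0| / tnth (V w) i)%:E < +oo)%E.
Proof.
move=> alpha2; pose rho k : R := 2^-1 ^+ k.
have rho0 k : 0 < rho k by rewrite exprn_gt0.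
pose E k := [set w | (rho k / 2) ^+ 2 < tnth (V w) i <= rho k ^+ 2].
pose f k w : \bar R := (`|KW i w + mu * h i 0| / (rho k / 2) ^+ 2)%:E.
have a0 k : 0 < (rho k / 2) ^+ 2 by rewrite exprn_gt0// divr_gt0.
apply: le_lt_trans; first apply: (@ge0_integral_cover_le _ _ _ _ _ E _ f).
- by move=> k; exact: measurable_cell.
- by move=> k; exact: measurable_abs_KW_shift.
- by move=> k w; rewrite lee_fin divr_ge0// ltW.
- move=> w /= /andP[v0 v1]; have [k] := sqr_itv_cover v0 v1.
  by rewrite /sqr_itv /= in_itv => kv; exists k.
- by move=> w /= /andP[v0 _]; rewrite lee_fin divr_ge0// ltW.
- move=> k w /= /andP[v0 _] /andP[av _]; rewrite lee_fin ler_wpM2l//.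
  by rewrite lef_pV2 ?posrE// ltW.
set q : R := 4 * expR (3 * mu ^+ 2 / (2 * sigma ^+ 2)).
have q0 : 0 <= q by rewrite mulr_ge0 ?expR_ge0.
set c : R := beta0 `^ alpha / gamma_fun alpha.
have c0 : 0 < c := gamma_pdf_cst_gt0 (gamma_prob_mixing_setT i).
(* The left endpoint has square root [rho k / 2], which turns [16] into [32]; [3 * c] comes from the
   gamma bound. *)
pose C := q * (`|mu| + 32 * sigma) * (3 * c).
pose z : R := 2 * 4^-1 `^ alpha.
have C0 : 0 <= C.
  apply: mulr_ge0; last by rewrite mulr_ge0// ltW.
  by apply: mulr_ge0 => //; rewrite addr_ge0// mulr_ge0// ltW.
have z0 : 0 <= z by rewrite mulr_ge0 ?powR_ge0.
have z1 : z < 1 by have := powR_quarter_lt alpha2; rewrite /z; lra.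
apply: le_lt_trans (nneseries_geometric_lty C0 z0 z1).
apply: lee_nneseries => [k _ _|k _].
  by apply: integral_ge0 => w _; rewrite lee_fin divr_ge0// ltW.
have b4 : rho k ^+ 2 <= 4 * (rho k / 2) ^+ 2 by rewrite exprMn; lra.
have rho1 : rho k <= 1 by rewrite exprn_ile1// invf_le1// ler1n.
have b1 : rho k ^+ 2 <= (rho k / 2) ^+ 2 + 1.
  by have := rho0 k; nra.
apply: (le_trans (integral_cell_abs_le i (a0 k) b4 b1)); rewrite -/q.
rewrite [X in (_ * X)%E]prob_sqr_cell.
have := gamma_prob_sqr_itv_le alpha0 beta00 (rho0 k) (gamma_prob_mixing_setT i).
rewrite -/c => Hg.
apply: (@le_trans _ _ ((q * (`|mu| + 16 * sigma / Num.sqrt ((rho k / 2) ^+ 2)))%:E *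
    (3 * c * (rho k ^+ 2) `^ alpha)%:E)%E).
  apply: lee_wpmul2l => //; rewrite lee_fin mulr_ge0// addr_ge0// divr_ge0//.
  by rewrite mulr_ge0 ?ltW.
rewrite -EFinM lee_fin sqrtr_sqr (@gtr0_norm _ (rho k / 2)) ?divr_gt0//.
have -> : (rho k ^+ 2) `^ alpha = (4^-1 `^ alpha) ^+ k.
  rewrite /rho -exprM mulnC exprM (_ : 2^-1 ^+ 2 = 4^-1); last by field.
  by rewrite -powR_mulrn// -powRrM mulrC powRrM powR_mulrn// powR_ge0.
have t0 : 0 <= (4^-1 `^ alpha) ^+ k :> R by rewrite exprn_ge0 ?powR_ge0.
have -> : C * z ^+ k = q * ((`|mu| + 32 * sigma) / rho k) *
    (3 * c * (4^-1 `^ alpha) ^+ k).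
  by rewrite /C /z exprMn /rho exprVn invrK; ring.
rewrite ler_wpM2r//; first by rewrite mulr_ge0// mulr_ge0// ltW.
rewrite ler_wpM2l// [leRHS]mulrDl lerD//.
  by rewrite ler_peMr// invf_ge1.
by rewrite le_eqVlt; apply/orP; left; apply/eqP; field; rewrite gt_eqF.
Qed.

(** On cells of unit length starting at [k.+1 >= 1], the cell bound is a constant [C] times the
    probability of the cell. The cells are disjoint, so the total is at most [C]. *)
Lemma integral_ratio_gt1_lty (i : 'I_n) :
  (\int[P]_(w in [set w | (1 < tnth (V w) i)%R])
     (`|KW i w + mu * h i 0| / tnth (V w) i)%:E < +oo)%E.
Proof.
pose E (k : nat) := [set w | k.+1%:R < tnth (V w) i <= k.+1%:R + 1].
pose f (k : nat) w : \bar R := (`|KW i w + mu * h i 0| / k.+1%:R)%:E.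
have mE k : measurable (E k) by exact: measurable_cell.
apply: le_lt_trans; first apply: (@ge0_integral_cover_le _ _ _ _ _ E _ f) => //.
- by move=> k; exact: measurable_abs_KW_shift.
- by move=> k w; rewrite lee_fin divr_ge0.
- by move=> w /= v1; have [k kv] := unit_itv_cover v1; exists k.
- by move=> w /= v1; rewrite lee_fin divr_ge0// (le_trans ler01)// ltW.
- move=> k w /= v1 /andP[kv _]; rewrite lee_fin ler_wpM2l//.
  by rewrite lef_pV2 ?posrE// ?ltr0n ?(lt_trans ltr01)// ltW.
set q : R := 4 * expR (3 * mu ^+ 2 / (2 * sigma ^+ 2)).
have q0 : 0 <= q by rewrite mulr_ge0 ?expR_ge0.
pose C := q * (`|mu| + 16 * sigma).
have C0 : 0 <= C by rewrite mulr_ge0// addr_ge0// mulr_ge0// ltW.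
apply: (@le_lt_trans _ _ (\sum_(k <oo) (C%:E * P (E k)))%E).
  apply: lee_nneseries => [k _ _|k _].
    by apply: integral_ge0 => w _; rewrite lee_fin divr_ge0.
  have k1 : 1 <= k.+1%:R :> R by rewrite ler1n.
  have b4 : k.+1%:R + 1 <= 4 * k.+1%:R :> R by lra.
  apply: (le_trans (integral_cell_abs_le i (lt_le_trans ltr01 k1) b4 (lexx _))).
  apply: lee_wpmul2r => //; rewrite lee_fin -/q ler_wpM2l// lerD2l.
  rewrite ler_piMr ?mulr_ge0 ?(ltW sigma0)// invf_le1 ?sqrtr_gt0 ?ltr0n//.
  by rewrite -[leLHS]sqrtr1 ler_wsqrtr.
rewrite nneseriesZl// -measure_semi_bigcup//; last 2 first.
- apply/trivIsetP => /= j k _ _; rewrite neq_lt => /orP[jk|jk];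
    apply/seteqP; split => // w [/= /andP[vj1 vj2] /andP[vk1 vk2]].
  + have : j.+1%:R + 1 <= k.+1%:R :> R by rewrite natr1 ler_nat ltnS.
    by move=> /(le_trans vj2) /(lt_le_trans vk1); rewrite ltxx.
  + have : k.+1%:R + 1 <= j.+1%:R :> R by rewrite natr1 ler_nat ltnS.
    by move=> /(le_trans vk2) /(lt_le_trans vj1); rewrite ltxx.
- exact: bigcup_measurable.
apply: (@le_lt_trans _ _ (C%:E * 1)%E); last by rewrite mule1 ltry.
by apply: lee_wpmul2l => //; apply: probability_le1; exact: bigcup_measurable.
Qed.

Lemma prob_mixing_le0 (i : 'I_n) : P [set w | tnth (V w) i <= 0] = 0%E.
Proof.
have := @law_V i `]-oo, 0] (measurable_itv _).
rewrite (_ : _ @^-1` _ = [set w | tnth (V w) i <= 0]); last first.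
  by apply/seteqP; split=> w /=; rewrite in_itv.
move=> ->; rewrite /gamma_prob integral0_eq// => x /=.
by rewrite in_itv/= /gamma_pdf => x0; rewrite ltNge x0.
Qed.

Lemma measurable_ratio (i : 'I_n) :
  measurable_fun setT (fun w => `|(KW i w + mu * h i 0) / tnth (V w) i|%:E).
Proof.
(* Inversion is rewritten as the power of exponent [- 1], a measurable function; at zero both take
   the default value zero. *)
rewrite (_ : (fun w => _) = (fun w => (`|KW i w + mu * h i 0| *
    `|tnth (V w) i| `^ (- 1))%:E)).
  apply/measurable_EFinP; apply: measurable_funM.
    apply: measurableT_comp => //; apply: measurable_funD => //.
    exact: measurable_KW.
  apply: (measurableT_comp (measurable_powR _)); apply: measurableT_comp => //.
  exact: measurable_mixing.
apply/funext => w; rewrite normrM normfV.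
have [->|v0] := eqVneq (tnth (V w) i) 0.
  by rewrite normr0 invr0 mulr0 powR0 ?mulr0// oppr_eq0 oner_eq0.
by rewrite powR_inv1.
Qed.

Lemma integral_ratio_lty (i : 'I_n) : 1 / 2 < alpha ->
  (\int[P]_w `|(KW i w + mu * h i 0) / tnth (V w) i|%:E < +oo)%E.
Proof.
move=> alpha2; have mG := measurable_ratio i.
pose N := [set w | tnth (V w) i <= 0].
have mN : measurable N.
  have := @measurable_mixingS i `]-oo, 0] (measurable_itv _).
  by congr measurable; apply/seteqP; split=> w /=; rewrite in_itv.
pose L := [set w | 0 < tnth (V w) i <= 1]; pose H := [set w | 1 < tnth (V w) i].
have mL : measurable L by exact: measurable_cell.
have mH : measurable H.
  have := @measurable_mixingS i `]1, +oo[ (measurable_itv _).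
  by congr measurable; apply/seteqP; split=> w /=; rewrite in_itv andbT.
have -> : [set: Omega] = N `|` (L `|` H).
  apply/seteqP; split=> // w _; rewrite /N /L /H /=.
  have [v0|v0] := leP (tnth (V w) i) 0; first by left.
  by right; have [v1|v1] := leP (tnth (V w) i) 1; [left|right].
rewrite ge0_integral_setU//; last 3 first.
- exact: measurableU.
- exact: measurable_funTS.
- apply/disj_setPS => w [/= v0 [/andP[v0' _]|v1]].
    by move: (le_lt_trans v0 v0'); rewrite ltxx.
  by move: (lt_trans v1 (le_lt_trans v0 ltr01)); rewrite ltxx.
rewrite null_set_integral ?add0e//; last 2 first.
- exact: measurable_funTS.
- exact: prob_mixing_le0.
rewrite ge0_integral_setU//; last 2 first.
- exact: measurable_funTS.
- apply/disj_setPS => w [/= /andP[_ v1] v1'].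
  by move: (le_lt_trans v1 v1'); rewrite ltxx.
apply: lte_add_pinfty.
- apply: le_lt_trans (integral_ratio_le1_lty i alpha2).
  apply: ge0_le_integral_subset => // w /= /andP[v0 _].
    by rewrite lee_fin divr_ge0// ltW.
  by rewrite lee_fin normrM normfV (gtr0_norm v0).
- apply: le_lt_trans (integral_ratio_gt1_lty i).
  apply: ge0_le_integral_subset => // w /= v1; have v0 := lt_trans ltr01 v1.
    by rewrite lee_fin divr_ge0// ltW.
  by rewrite lee_fin normrM normfV (gtr0_norm v0).
Qed.

(** * Lower bounds on boxes and divergence *)

(* [box i r] is the event on which, at a scale [r], the mixing variable is of
   order [r ^+ 2] and [KW i + mu * h i] of order [r]. *)
Let scale (i : 'I_n) (r : R) (j : 'I_n) : R := if j == i then r else 1.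
Let box (i : 'I_n) (r : R) : set Omega :=
  [set w | forall j, sqr_itv (scale i r j) (tnth (V w) j)] `&`
  [set w | forall j,
    `]scale i r j - mu * h j 0, 2 * scale i r j - mu * h j 0]%classic (KW j w)].

Lemma measurable_box i r : measurable (box i r).
Proof.
rewrite /box; apply: measurableI.
  apply: (@measurable_mixing_box (fun j => sqr_itv (scale i r j))) => j.
  exact: measurable_itv.
rewrite (_ : [set w | _] = \bigcap_(j in [set: 'I_n]) (KW j @^-1`
    `]scale i r j - mu * h j 0, 2 * scale i r j - mu * h j 0]%classic)).
  apply: fin_bigcap_measurable; first exact: finite_finset.
  move=> j _; rewrite -[X in measurable X]setTI.
  by apply: measurable_KW => //; exact: measurable_itv.
by apply/seteqP; split=> w /= wB j => [_|]; exact: wB.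
Qed.

(** Coordinates other than [i] stay at scale one, so the scales multiply to [r]. Each coordinate
    contributes at least [g] through the normal law and [k] times its scale through the gamma law,
    whence the witness [(g * k) ^+ n]. *)
Lemma prob_box_ge (i : 'I_n) : alpha <= 1 / 2 ->
  exists2 delta : R, 0 < delta &
    forall r : R, 0 < r -> r <= 1 -> ((delta * r)%:E <= P (box i r))%E.
Proof.
move=> alpha2.
pose g : R := normal_peak 1 / sigma * expR (- (2 * (2 + `|mu|) ^+ 2 / sigma ^+ 2)).
have g0 : 0 < g
  by rewrite mulr_gt0 ?expR_gt0// divr_gt0// normal_peak_gt0// oner_neq0.
have mass1 := gamma_prob_mixing_setT i.
have c0 := gamma_pdf_cst_gt0 mass1.
pose k : R := 3 / 4 * (beta0 `^ alpha / gamma_fun alpha) * 4^-1 `^ alpha * expR (- beta0).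
have k0 : 0 < k by rewrite mulr_gt0 ?expR_gt0// mulr_gt0 ?powR_gt0// mulr_gt0.
exists ((g * k) ^+ n) => [|r r0 r1]; first by rewrite exprn_gt0// mulr_gt0.
have s0 j : 0 < scale i r j by rewrite /scale; case: ifP.
have s1 j : scale i r j <= 1 by rewrite /scale; case: ifP.
have prods : \prod_(j < n) scale i r j = r.
  rewrite (bigD1 i)//= {1}/scale eqxx big1 ?mulr1// => j ji.
  by rewrite /scale (negbTE ji).
have mC j : measurable (sqr_itv (scale i r j)) by exact: measurable_itv.
rewrite /box (@prob_mixing_KW_box (fun j => sqr_itv (scale i r j))
  (fun j => `]scale i r j - mu * h j 0, 2 * scale i r j - mu * h j 0]%classic));
  last 3 first.
- exact: mC.
- by move=> j; exact: measurable_itv.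
- move=> j x; rewrite /sqr_itv /= in_itv/= => /andP[+ _].
  by apply: le_lt_trans; rewrite sqr_ge0.
set D := [set w | forall j, sqr_itv _ _].
have mD : measurable D by exact: measurable_mixing_box mC.
apply: (@le_trans _ _ (\int[P]_(w in D) cst (g ^+ n)%:E w)%E); last first.
  apply: ge0_le_integral_subset => // w Dw.
  - by rewrite lee_fin exprn_ge0// ltW.
  - by apply: prode_ge0.
  have -> : g ^+ n = \prod_(j < n) g by rewrite prodr_const card_ord.
  apply: lee_prod_EFin => j; first exact: ltW.
  have := Dw j; rewrite /sqr_itv /= in_itv/= => /andP[? ?].
  exact: normal_prob_mixture_ge.
rewrite integral_cst// exprMn -mulrA EFinM; apply: lee_wpmul2l.
  by rewrite lee_fin exprn_ge0// ltW.
rewrite [X in (_ <= X)%E](prob_mixing_box mC).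
have -> : k ^+ n * r = \prod_(j < n) (k * scale i r j).
  by rewrite big_split/= prods prodr_const card_ord.
apply: lee_prod_EFin => j; first by rewrite mulr_ge0// ltW.
apply: le_trans (gamma_prob_sqr_itv_ge alpha0 beta00 (s0 j) (s1 j) mass1).
by rewrite lee_fin -/k ler_pM2l// le_powR_sqr.
Qed.

(** The weight [F] stands for the likelihood. On the box at scale [rho k] the ratio is at least
    [(rho k)^-1], while the box has probability at least [delta * rho k]; each of these disjoint
    boxes thus contributes at least [e * delta]. *)
Lemma integral_ratio_weighted_eqy (i : 'I_n) (F : Omega -> R) (e : R) :
  alpha <= 1 / 2 -> 0 < e -> (forall w, 0 <= F w) ->
  (forall w, (forall j, 0 <= KW j w + mu * h j 0 <= 2) -> e <= F w) ->
  (\int[P]_w (`|(KW i w + mu * h i 0) / tnth (V w) i| * F w)%:E = +oo)%E.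
Proof.
move=> alpha2 e0 F0 eF; have [delta delta0 Pdelta] := prob_box_ge i alpha2.
pose rho k : R := 2^-1 ^+ k.
have rho0 k : 0 < rho k by rewrite exprn_gt0.
have rho1 k : rho k <= 1 by rewrite exprn_ile1// invf_le1// ler1n.
have boxV k w : box i (rho k) w -> (rho k / 2) ^+ 2 < tnth (V w) i <= rho k ^+ 2.
  by move=> -[/(_ i) + _]; rewrite /scale eqxx /sqr_itv /= in_itv.
have boxF k w : box i (rho k) w ->
    (rho k)^-1 * e <= `|(KW i w + mu * h i 0) / tnth (V w) i| * F w.
  move=> bw; have /andP[v1 v2] := boxV _ _ bw; move: bw => -[_ bw].
  have v0 : 0 < tnth (V w) i by apply: le_lt_trans v1; rewrite sqr_ge0.
  apply: ler_pM; rewrite ?invr_ge0 ?(ltW e0) ?(ltW (rho0 _))//; last first.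
    apply: eF => j; have := bw j; rewrite /= in_itv/= => /andP[].
    have : 0 < scale i (rho k) j by rewrite /scale; case: ifP.
    have : scale i (rho k) j <= 1 by rewrite /scale; case: ifP.
    by lra.
  have := bw i; rewrite /scale eqxx /= in_itv/= => /andP[+ _].
  rewrite ltrBlDr => ku; rewrite gtr0_norm; last first.
    by rewrite divr_gt0// (lt_trans _ ku).
  rewrite ler_pdivlMr//; apply: le_trans (ltW ku).
  by rewrite mulrC ler_pdivrMr//; move: v2; rewrite expr2.
(* For [j < k] the right endpoint of cell [k] does not exceed the left endpoint of cell [j]. *)
have boxI j k w : (j < k)%N -> box i (rho j) w -> box i (rho k) w -> False.
  move=> jk /boxV/andP[v1 _] /boxV/andP[_ v2].
  have : rho k <= rho j / 2.
    rewrite /rho -exprSr; apply: ler_wiXn2l => //.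
    by rewrite invf_le1// ler1n.
  by have := rho0 k; have := rho0 j; nra.
apply/eqyP => M M0.
have [N MN] : exists N : nat, M <= e * delta * N%:R.
  have ed0 : 0 < e * delta by rewrite mulr_gt0.
  exists (Num.bound (M / (e * delta))); rewrite mulrC -ler_pdivrMr//.
  by apply/ltW/archi_boundP; rewrite divr_ge0// ltW.
apply: (@le_trans _ _ (\sum_(k < N) ((rho k)^-1 * e)%:E * P (box i (rho k)))%E).
  apply: (@le_trans _ _ (\sum_(k < N) (e * delta)%:E)%E).
    by rewrite sumEFin lee_fin sumr_const card_ord -mulr_natr.
  apply: lee_sum => k _.
  apply: (@le_trans _ _ (((rho k)^-1 * e)%:E * (delta * rho k)%:E)%E).
    rewrite -EFinM lee_fin le_eqVlt; apply/orP; left; apply/eqP.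
    by field; rewrite gt_eqF.
  apply: lee_wpmul2l; last exact: Pdelta.
  by rewrite lee_fin mulr_ge0 ?invr_ge0 ?ltW.
have E0 k w : (0 <= ((rho k)^-1 * e * \1_(box i (rho k)) w)%:E)%E.
  by rewrite lee_fin mulr_ge0// mulr_ge0 ?invr_ge0 ?ltW.
have -> : (\sum_(k < N) ((rho k)^-1 * e)%:E * P (box i (rho k)) =
    \int[P]_w \sum_(k < N) ((rho k)^-1 * e * \1_(box i (rho k)) w)%:E)%E.
  rewrite ge0_integral_sum//; last first.
    move=> k; apply/measurable_EFinP; apply: measurable_funM => //.
    exact: (@measurable_indic _ _ R setT _ (measurable_box _ _)).
  apply: eq_bigr => k _; under eq_integral do rewrite EFinM.
  rewrite ge0_integralZl_EFin//; last 2 first.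
  - apply/measurable_EFinP.
    exact: (@measurable_indic _ _ R setT _ (measurable_box _ _)).
  - by rewrite mulr_ge0 ?invr_ge0 ?ltW.
  by rewrite integral_indic ?setIT//; exact: measurable_box.
apply: ge0_le_integral_subset => // w _.
- exact: sume_ge0.
- by rewrite lee_fin mulr_ge0.
(* By disjointness at most one term of the sum is nonzero at [w]. *)
have [[k bk]|nb] := pselect (exists k : 'I_N, box i (rho k) w).
  rewrite (bigD1 k)//= big1 => [|j jk].
    by rewrite adde0 indicE mem_set// mulr1 lee_fin boxF.
  rewrite indicE memNset ?mulr0// => bj.
  move: jk; rewrite -val_eqE /= neq_ltn => /orP[jk|jk]; first exact: boxI jk bj bk.
  exact: boxI jk bk bj.
rewrite big1 ?lee_fin ?mulr_ge0// => k _.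
by rewrite indicE memNset ?mulr0// => bk; apply: nb; exists k.
Qed.

End mixture_model.

(** * Bounds on the Gaussian likelihood *)

Lemma mvnormal_pdf_scalar (R : realType) (n : nat) (a x : 'cV[R]_n) (s : R) :
  mvnormal_pdf a s%:M x =
  (Num.sqrt ((2 * pi) ^+ n * s ^+ n))^-1 *
  expR (- (2^-1 * (s^-1 * \sum_j (x j 0 - a j 0) ^+ 2))).
Proof.
rewrite /mvnormal_pdf det_scalar invmx_scalar mul_mx_scalar -scalemxAl.
congr (_ * expR (- (_ * _))); rewrite !mxE; congr (_ * _).
by apply: eq_bigr => j _; rewrite !mxE expr2.
Qed.

Lemma mvnormal_pdf_scalar_ge0 (R : realType) (n : nat) (a x : 'cV[R]_n) (s : R) :
  0 <= mvnormal_pdf a s%:M x.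
Proof. by rewrite mvnormal_pdf_scalar mulr_ge0 ?expR_ge0// invr_ge0. Qed.

Lemma mvnormal_pdf_scalar_le (R : realType) (n : nat) (a x : 'cV[R]_n) (s : R) :
  0 < s ->
  mvnormal_pdf a s%:M x <= (Num.sqrt ((2 * pi) ^+ n * s ^+ n))^-1.
Proof.
move=> s0; rewrite mvnormal_pdf_scalar ler_piMr ?invr_ge0//.
rewrite -[leRHS]expR0 ler_expR oppr_le0 !mulr_ge0 ?invr_ge0 ?(ltW s0)//.
by apply: sumr_ge0 => j _; exact: sqr_ge0.
Qed.

(** Bounded residuals give a bounded quadratic form. One [e] serves all means [a], as is needed when
    the mean depends on [W]. *)
Lemma mvnormal_pdf_scalar_gt0_bounded (R : realType) (n : nat) (s : R)
    (b : 'I_n -> R) :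
  0 < s -> exists2 e : R, 0 < e & forall a x : 'cV[R]_n,
    (forall j, `|x j 0 - a j 0| <= b j) -> e <= mvnormal_pdf a s%:M x.
Proof.
move=> s0.
exists ((Num.sqrt ((2 * pi) ^+ n * s ^+ n))^-1 *
    expR (- (2^-1 * (s^-1 * \sum_j b j ^+ 2)))).
  rewrite mulr_gt0 ?expR_gt0// invr_gt0 sqrtr_gt0.
  by rewrite mulr_gt0 ?exprn_gt0// mulr_gt0// pi_gt0.
move=> a x ab; rewrite mvnormal_pdf_scalar ler_wpM2l ?invr_ge0//.
rewrite ler_expR lerN2 !ler_wpM2l ?invr_ge0 ?(ltW s0)//.
apply: ler_sum => j _; rewrite -[leLHS]real_normK ?num_real//.
rewrite ler_sqr ?nnegrE//; exact: le_trans (ab j).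
Qed.

(** * The posterior expectation *)

Unset Implicit Arguments.

Theorem lemma3p1 (R : realType) (d : measure_display) (Omega : measurableType d)
    (P : probability Omega R) (m n p : nat)
    (A : 'M[R]_(m, n)) (K : 'M[R]_n) (X : 'M[R]_(m, p)) (beta : 'cV[R]_p)
    (h : 'cV[R]_n) (mu sigma sigma_eps alpha beta0 : R)
    (Y : {RV P >-> m.-tuple R}) (W V : {RV P >-> n.-tuple R})
    (i : 'I_n) (y : 'cV[R]_m) :
  0 < sigma -> 0 < sigma_eps -> 0 < alpha -> 0 < beta0 ->
  K \in unitmx ->
  mutually_independent P (fun (j : 'I_n) w => tnth (V w) j) ->
  (forall (j : 'I_n) (B : set R), measurable B ->
     P ((fun w => tnth (V w) j) @^-1` B) = gamma_prob alpha beta0 B) ->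
  conditional_law P V (fun w => tcol (K *m colt (W w)))
    (fun v => mvnormal_prob (mu *: colt v - mu *: h)
                (diag_mx (sigma ^+ 2 *: (colt v)^T))) ->
  conditional_law P (fun w => (W w, V w)) Y
    (fun wv => mvnormal_prob (X *m beta + A *m colt wv.1)
                 (sigma_eps ^+ 2)%:M) ->
  let f (wv : n.-tuple R * n.-tuple R) :=
    mvnormal_pdf (X *m beta + A *m colt wv.1) (sigma_eps ^+ 2)%:M in
  (0 < marginal_density P (fun w => (W w, V w)) f y < +oo)%E ->
  let posterior_mean := posterior_expectation P (fun w => (W w, V w)) f y
    (fun wv => `| ((K *m colt wv.1) i 0 + mu * h i 0) / tnth wv.2 i |) in
  (posterior_mean \is a fin_num <-> 1 / 2 < alpha) /\
  (alpha <= 1 / 2 -> posterior_mean = +oo%E).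
Proof.
move=> sigma0 eps0 alpha0 beta00 uK indep law_V law_KW _ f /andP[M0 Moo] mean.
have eps20 : 0 < sigma_eps ^+ 2 by rewrite exprn_gt0.
have f0 wv : 0 <= f wv y by exact: mvnormal_pdf_scalar_ge0.
pose I := (\int[P]_w (`|((K *m colt (W w)) i 0 + mu * h i 0) / tnth (V w) i| *
  f (W w, V w) y)%:E)%E.
pose M := marginal_density P (fun w => (W w, V w)) f y.
have meanE : mean = (I / M)%E by [].
have Mfin : M \is a fin_num by rewrite ge0_fin_numE// ltW.
(* A positive finite inverse preserves both finiteness and the value [+oo], so only the numerator
   [I] matters. *)
have M1 : (0 < M^-1)%E /\ M^-1%E \is a fin_num.
  move: Mfin M0; rewrite -/M => /fineK <-; rewrite lte_fin => M0.
  by rewrite inver gt_eqF//= lte_fin invr_gt0.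
have infinite : alpha <= 1 / 2 -> mean = +oo%E.
  move=> alpha2; rewrite meanE.
  (* Since [K] is invertible, [A *m W] equals [N *m (K *m W)], so bounds on [KW] bound the residuals
     of [y]. When [KW j + mu * h j] lies between [0] and [2], [b j] bounds the absolute value of
     [KW j]. *)
  pose N := A *m invmx K; pose b j := 2 + `|mu * h j 0|.
  have [e e0 fe] := mvnormal_pdf_scalar_gt0_bounded
    (fun r => `|(y - X *m beta) r 0| + \sum_l `|N r l| * b l) eps20.
  rewrite /I (integral_ratio_weighted_eqy sigma0 alpha0 beta00 indep law_V law_KW
    i alpha2 e0)//.
    by rewrite gt0_mulye//; case: M1.
  move=> w KWb; apply: fe => r.
  have -> : A *m colt (W w) = N *m (K *m colt (W w)).
    by rewrite /N -mulmxA mulKmx.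
  rewrite [(X *m beta + _) r 0]mxE opprD addrA.
  apply: (le_trans (ler_normB _ _)); apply: lerD; first by rewrite !mxE.
  rewrite mxE; apply: (le_trans (ler_norm_sum _ _ _)); apply: ler_sum => l _.
  rewrite normrM ler_wpM2l// /b.
  have -> : (K *m colt (W w)) l 0 = (K *m colt (W w)) l 0 + mu * h l 0 - mu * h l 0.
    by rewrite addrK.
  apply: (le_trans (ler_normB _ _)); rewrite lerD2r.
  by have /andP[K0 K2] := KWb l; rewrite ger0_norm.
split=> //; split=> [fin|alpha2].
  by rewrite ltNge; apply/negP => /infinite meany; rewrite meany in fin.
rewrite meanE fin_numM//; last by case: M1.
rewrite ge0_fin_numE; last by apply: integral_ge0 => w _; rewrite lee_fin mulr_ge0.
(* The normalising constant bounds the likelihood from above, which reduces the claim to the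
   unweighted ratio. *)
set c := (Num.sqrt ((2 * pi) ^+ m * (sigma_eps ^+ 2) ^+ m))^-1.
have c0 : 0 <= c by rewrite invr_ge0.
apply: (@le_lt_trans _ _ (\int[P]_w (c%:E *
    `|((K *m colt (W w)) i 0 + mu * h i 0) / tnth (V w) i|%:E))%E).
  apply: ge0_le_integral_subset => // w _.
  - by rewrite lee_fin mulr_ge0.
  - by rewrite mule_ge0 ?lee_fin.
  by rewrite -EFinM lee_fin mulrC ler_wpM2r//; exact: mvnormal_pdf_scalar_le.
rewrite ge0_integralZl_EFin//; last exact: measurable_ratio.
apply: lte_mul_pinfty => //; rewrite ?lee_fin//.
exact: (integral_ratio_lty sigma0 alpha0 beta00 indep law_V law_KW i alpha2).
Qed.
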